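(* Let $(\mathsf{E},\mathcal{F},\mu)$ be a probability space and let $P$ be a $\mu$-invariant Markov kernel on $\mathsf{E}$ such that, for some measurable $\varepsilon:\mathsf{E}\to[0,1]$, $P(x,A)\ge\varepsilon(x)\,\delta_{x}(A)$ for all $(x,A)\in\mathsf{E}\times\mathcal{F}$. Then: (1) for all $(x,A)\in\mathsf{E}\times\mathcal{F}$, $P^{2}(x,A)\ge\varepsilon(x)P(x,A)$; (2) for any $p\in(1,\infty]$, with $1/q=1-1/p$, any $f\in\mathrm{L}_{0}^{2p}(\mu)$ and any $s>0$, \[ \mathcal{E}(P,f)\le s\,\mathcal{E}(P^{2},f)+\mu\big(\varepsilon(X)^{-1}\ge s\big)^{1/q}\,\Phi_{p}(f), \] where $\Phi_{p}(f):=4\|f\|_{2p}^{2}$ if $p\in(1,\infty)$ and $\Phi_{\infty}(f):=\|f\|_{\mathrm{osc}}^{2}$.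
   Context: $\delta_{x}$ is the point mass at $x$; $\varepsilon(x)^{-1}=\infty$ when $\varepsilon(x)=0$. $\mathrm{L}_{0}^{r}(\mu)$ consists of $f$ with $\int|f|^{r}\mathrm{d}\mu<\infty$ and $\mu(f)=0$, $\|f\|_{r}=(\int|f|^{r}\mathrm{d}\mu)^{1/r}$, and $\|f\|_{\mathrm{osc}}:=\operatorname{ess\,sup}_{\mu}f-\operatorname{ess\,inf}_{\mu}f$. For a Markov kernel $T$, $\mathcal{E}(T,f):=\langle(\mathrm{Id}-T)f,f\rangle$ in $\mathrm{L}^{2}(\mu)$. *)

(* Defs.v *)
From HB Require Import structures.
From mathcomp Require Import all_boot all_order all_algebra.
From mathcomp Require Import all_classical all_reals all_analysis.
From mathcomp Require Import ess_sup_inf hoelder kernel.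
Set Implicit Arguments. Unset Strict Implicit. Unset Printing Implicit Defensive.
Import Order.TTheory GRing.Theory Num.Theory.
Import numFieldNormedType.Exports.
Local Open Scope classical_set_scope.
Local Open Scope ring_scope.

(* Markov operator: (T f)(x) = \int f(y) T(x, dy)  (real part; the integral is
   finite mu-a.e. for the f considered, which is all that matters below). *)
Definition kapply d (E : measurableType d) (R : realType)
  (T : E -> {measure set E -> \bar R}) (f : E -> R) (x : E) : R :=
  fine (\int[T x]_y (f y)%:E).

Definition dirichlet d (E : measurableType d) (R : realType)
  (mu : {measure set E -> \bar R})
  (T : E -> {measure set E -> \bar R}) (f : E -> R) : R :=
  Rintegral mu [set: E] (fun x => (f x - kapply T f x) * f x).

Definition mu_invariant d (E : measurableType d) (R : realType)
  (mu : {measure set E -> \bar R}) (T : E -> {measure set E -> \bar R}) :=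
  forall A, measurable A -> (\int[mu]_x T x A = mu A)%E.

Definition inv_ext d (E : measurableType d) (R : realType) (eps : E -> R)
  (x : E) : \bar R :=
  if eps x == 0 then +oo%E else ((eps x)^-1)%:E.

Definition osc_norm d (E : measurableType d) (R : realType)
  (mu : {measure set E -> \bar R}) (f : E -> R) : R :=
  fine (ess_sup mu (EFin \o f) - ess_inf mu (EFin \o f))%E.

Definition rnorm d (E : measurableType d) (R : realType)
  (mu : {measure set E -> \bar R}) (r : R) (f : E -> R) : R :=
  fine (Lnorm mu r%:E (EFin \o f)).

(* Main.v *)
Require Import Defs.
From HB Require Import structures.
From mathcomp Require Import all_boot all_order all_algebra.
From mathcomp Require Import all_classical all_reals all_analysis.
From mathcomp Require Import ess_sup_inf hoelder kernel.
From mathcomp Require Import measurable_realfun ring lra.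
Import Order.TTheory GRing.Theory Num.Theory.
Import numFieldNormedType.Exports.
Local Open Scope classical_set_scope.
Local Open Scope ring_scope.
Set Implicit Arguments. Unset Strict Implicit. Unset Printing Implicit Defensive.

(* For a mu-invariant Markov kernel T and f in L^2(mu), the Dirichlet form is
   half the integral over mu of h_T(x) = \int (f x - f y)^2 T(x, dy).
   Lower-bounding the first step of P^2 by the holding probability gives
   P^2(x, .) >= eps(x) P(x, .), hence h_P <= s h_(P^2) wherever s eps(x) > 1.
   On the remaining set A = {1/eps >= s}, h_P is bounded mu-a.e. by the squared
   oscillation when p = oo; when p < oo,
   (f x - f y)^2 <= 2 (f x)^2 + 2 (f y)^2, and Hoelder's inequality against the
   indicator of A together with Jensen's inequality for P(x, .) concludes.
   This yields the constants 2 and 1/2 in place of 4 and 1. *)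

(** * Invariance and minorization for Markov kernels *)

Section markov_kernel.
Context (d : measure_display) (E : measurableType d) (R : realType).

(** Invariance says that [mu] followed by [T] agrees with [mu] on measurable sets, and integrating
    against a composite kernel is iterated integration. *)
Lemma integral_mu_invariant (mu : probability E R) (T : R.-spker E ~> E)
  (g : E -> \bar R) :
  mu_invariant mu T -> measurable_fun [set: E] g -> (forall x, 0 <= g x)%E ->
  (\int[mu]_x \int[T x]_y g y = \int[mu]_x g x)%E.
Proof.
move=> muT mg g0.
(* [mu] is viewed as a constant kernel from [unit], so that the Fubini-type formula for composed
   kernels applies. *)
pose l : R.-sfker unit ~> E :=
  kprobability (measurable_cst (mu : pprobability E R)).
have := @integral_kcomp _ _ _ _ _ _ R l (kernel.kernel_snd T) tt g g0 mg.
rewrite /= => <-; apply: (eq_measure_integral mu) => A mA _.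
exact: muT.
Qed.

Lemma mu_invariant_comp (mu : probability E R) (S T : R.-spker E ~> E) :
  mu_invariant mu S -> mu_invariant mu T ->
  mu_invariant mu (mkcomp_noparam S T).
Proof.
move=> muS muT A mA; rewrite -muT//.
exact: (@integral_mu_invariant _ _ (T ^~ A) muS (measurable_kernel T A mA)).
Qed.

(** If the null set [N] contains all points where [Q] fails, then [T x N] has [mu]-integral
    [mu N = 0]; being nonnegative, it vanishes for almost every [x]. *)
Lemma ae_mu_invariant (mu : probability E R) (T : R.-spker E ~> E) (Q : set E) :
  mu_invariant mu T -> (\forall y \ae mu, Q y) ->
  \forall x \ae mu, \forall y \ae T x, Q y.
Proof.
move=> muT [N [mN N0 QN]].
have : (\int[mu]_x `|T x N|)%E = 0%E.
  rewrite -[RHS]N0 -muT//; apply: eq_integral => x _; exact: gee0_abs.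
move/(ae_eq_integral_abs mu measurableT (measurable_kernel T N mN)).
by apply: filterS => x /(_ I) /= TN; exists N.
Qed.

Lemma integral_scale_le (m1 m2 : {measure set E -> \bar R}) (c : R)
  (g : E -> \bar R) :
  0 <= c -> (forall A, measurable A -> (c%:E * m1 A <= m2 A)%E) ->
  measurable_fun [set: E] g -> (forall x, 0 <= g x)%E ->
  (c%:E * \int[m1]_x g x <= \int[m2]_x g x)%E.
Proof.
move=> c0 m12 mg g0; rewrite -(ge0_integral_mscale m1 _ (NngNum c0))//.
exact: ge0_le_measure_integral.
Qed.

(** Integrate [y |-> P y A] against [P x], which dominates [c] times the point mass at [x]. *)
Lemma kernel_sqr_ge (P : R.-spker E ~> E) (c : R) (x : E) :
  0 <= c -> (forall A, measurable A -> (c%:E * dirac x A <= P x A)%E) ->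
  forall A, measurable A -> (c%:E * P x A <= mkcomp_noparam P P x A)%E.
Proof.
move=> c0 cP A mA.
have := integral_scale_le c0 cP (measurable_kernel P A mA)
  (fun y => measure_ge0 (P y) A).
by rewrite integral_dirac ?diracT ?mul1e//; exact: measurable_kernel.
Qed.

End markov_kernel.

(** * The Dirichlet form as an integrated local energy *)

Section local_energy.
Context (d : measure_display) (E : measurableType d) (R : realType).

(** Twice the carré du champ of [T - Id] at [f]. Values in [\bar R] keep it meaningful at points
    where [f] is not square-integrable under [T x]. *)
Definition local_energy (T : E -> {measure set E -> \bar R}) (f : E -> R)
  (x : E) : \bar R := (\int[T x]_y ((f x - f y) ^+ 2)%:E)%E.

Lemma local_energy_ge0 T f x : (0 <= local_energy T f x)%E.
Proof. by apply: integral_ge0 => y _; rewrite lee_fin sqr_ge0. Qed.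

Lemma measurable_sqrB (f : E -> R) (a : R) : measurable_fun [set: E] f ->
  measurable_fun [set: E] (fun y => ((a - f y) ^+ 2)%:E).
Proof.
move=> mf; apply/measurable_EFinP; apply: measurable_funX.
exact: measurable_funB.
Qed.

Lemma measurable_sqr (f : E -> R) : measurable_fun [set: E] f ->
  measurable_fun [set: E] (fun y => (f y ^+ 2)%:E).
Proof. by move=> mf; apply/measurable_EFinP; exact: measurable_funX. Qed.

Lemma measurable_local_energy (T : R.-spker E ~> E) (f : E -> R) :
  measurable_fun [set: E] f -> measurable_fun [set: E] (local_energy T f).
Proof.
move=> mf.
apply: (measurable_kfcomp T (f := fun z => ((f z.1 - f z.2) ^+ 2)%:E)).
  apply/measurable_EFinP; apply: measurable_funX.
  by apply: measurable_funB; exact: measurableT_comp.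
by move=> z; rewrite lee_fin sqr_ge0.
Qed.

Lemma local_energy_le (T : R.-spker E ~> E) (f : E -> R) (x : E) :
  T x setT = 1%E -> measurable_fun [set: E] f ->
  (local_energy T f x <=
   2%:E * (f x ^+ 2)%:E + 2%:E * \int[T x]_y (f y ^+ 2)%:E)%E.
Proof.
move=> T1 mf; have m2 := measurable_sqr mf.
rewrite -ge0_integralZl//; last by move=> y _; rewrite lee_fin sqr_ge0.
(* Since [T x] has mass 1, the term in [f x] is the integral of a constant, which leaves a pointwise
   comparison under one integral. *)
rewrite -[X in (X + _)%E]mule1 -T1 -integral_cst// -ge0_integralD//; last first.
- exact: emeasurable_funM.
- by move=> y _; rewrite -EFinM lee_fin mulr_ge0// sqr_ge0.
- by move=> y _; rewrite -EFinM lee_fin mulr_ge0// sqr_ge0.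
apply: ge0_le_integral => //.
- by move=> y _; rewrite lee_fin sqr_ge0.
- exact: measurable_sqrB.
- by apply: emeasurable_funD => //; exact: emeasurable_funM.
- move=> y _; rewrite /cst -!EFinM -EFinD lee_fin.
  (* The gap between the two sides is exactly [(f x + f y) ^+ 2]. *)
  have := sqr_ge0 (f x + f y); nra.
Qed.

Context (mu : probability E R) (T : R.-spker E ~> E) (f : E -> R).
Hypotheses (muT : mu_invariant mu T) (T1 : forall x, T x setT = 1%E).
Hypotheses (mf : measurable_fun [set: E] f).
Hypotheses (f2 : (\int[mu]_x (f x ^+ 2)%:E < +oo)%E).

Let G x := (\int[T x]_y (f y ^+ 2)%:E)%E.

Let G0 x : (0 <= G x)%E.
Proof. by apply: integral_ge0 => y _; rewrite lee_fin sqr_ge0. Qed.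

Let mG : measurable_fun [set: E] G.
Proof.
apply: measurable_fun_integral_kernel.
- exact: measurable_kernel.
- by move=> z; rewrite lee_fin sqr_ge0.
- exact: measurable_sqr.
Qed.

Let int_G : (\int[mu]_x G x = \int[mu]_x (f x ^+ 2)%:E)%E.
Proof.
apply: integral_mu_invariant => //; first exact: measurable_sqr.
by move=> z; rewrite lee_fin sqr_ge0.
Qed.

Lemma integral_local_energy_lty : (\int[mu]_x local_energy T f x < +oo)%E.
Proof.
have m2 := measurable_sqr mf.
apply: (@le_lt_trans _ _
  (\int[mu]_x (2%:E * (f x ^+ 2)%:E + 2%:E * G x))%E); last first.
  rewrite ge0_integralD//; first last.
  - exact: emeasurable_funM.
  - by move=> x _; rewrite mule_ge0.
  - exact: emeasurable_funM.
  - by move=> x _; rewrite -EFinM lee_fin mulr_ge0// sqr_ge0.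
  rewrite !ge0_integralZl//; last by move=> x _; rewrite lee_fin sqr_ge0.
  by rewrite int_G lte_add_pinfty// lte_mul_pinfty.
apply: ge0_le_integral => //.
- by move=> x _; exact: local_energy_ge0.
- exact: measurable_local_energy.
- by apply: emeasurable_funD; exact: emeasurable_funM.
- by move=> x _; exact: local_energy_le.
Qed.

Let measurable_kapply : measurable_fun [set: E] (kapply T f).
Proof.
apply: (@measurableT_comp _ _ _ _ _ _ fine) => /=; first exact: fine_measurable.
rewrite (_ : (fun x => _) =
  (fun x => \int[T x]_y (EFin \o f)^\+ y - \int[T x]_y (EFin \o f)^\- y)%E);
  last by apply/funext => x; rewrite integralE.
apply: emeasurable_funB; apply: measurable_fun_integral_kernel => //.
- exact: measurable_kernel.
- by apply: measurable_funepos; exact/measurable_EFinP.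
- exact: measurable_kernel.
- by apply: measurable_funeneg; exact/measurable_EFinP.
Qed.

Let local_energyE x : (G x < +oo)%E ->
  local_energy T f x = (f x ^+ 2 - 2 * f x * kapply T f x + fine (G x))%:E.
Proof.
move=> Gx.
have i2 : (T x).-integrable setT (fun y => (f y ^+ 2)%:E).
  apply/integrableP; split; first exact: measurable_sqr.
  under eq_integral do rewrite gee0_abs ?lee_fin ?sqr_ge0//.
  by [].
have ic c : (T x).-integrable setT (fun=> c%:E).
  apply/integrableP; split => //.
  by rewrite integral_cst// T1 mule1 ltry.
(* [|f| <= 1 + f ^+ 2], and constants are integrable under [T x]. *)
have i1 : (T x).-integrable setT (EFin \o f).
  apply: (le_integrable measurableT _ _ (integrableD measurableT (ic 1) i2)).
  - exact/measurable_EFinP.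
  - move=> y _ /=; rewrite lee_fin (ger0_norm (addr_ge0 ler01 (sqr_ge0 (f y)))).
    by rewrite ler_norml; have := sqr_ge0 (f y + 1); have := sqr_ge0 (f y - 1);
      nra.
have i1' : (T x).-integrable setT (fun y => (- (2 * f x))%:E * (f y)%:E)%E.
  exact: integrableZl.
rewrite /local_energy.
transitivity (\int[T x]_y
  (((f x ^+ 2)%:E + (- (2 * f x))%:E * (f y)%:E) + (f y ^+ 2)%:E))%E.
  by apply: eq_integral => y _; rewrite -EFinM -!EFinD; congr EFin; ring.
rewrite integralD//; last exact: integrableD.
rewrite integralD// integral_cst// T1 mule1 integralZl//.
rewrite -(fineK (integrable_fin_num measurableT i1)).
rewrite -/(G x) -[in LHS](@fineK _ (G x)) ?ge0_fin_numE//.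
by rewrite -EFinM -!EFinD mulNr.
Qed.

(** Where [G x] is finite, expanding the square gives [(f - T f) * f] as half of
    [local_energy T f + (f ^+ 2 - G)]. By invariance [G] and [f ^+ 2] have the same finite integral,
    so the bracket integrates to 0. *)
Lemma dirichletE :
  dirichlet mu T f = 2^-1 * fine (\int[mu]_x local_energy T f x)%E.
Proof.
have iH : mu.-integrable setT (local_energy T f).
  apply/integrableP; split; first exact: measurable_local_energy.
  under eq_integral do rewrite gee0_abs ?local_energy_ge0//.
  exact: integral_local_energy_lty.
have iG : mu.-integrable setT G.
  apply/integrableP; split => //.
  under eq_integral do rewrite gee0_abs//.
  by rewrite int_G.
have i2 : mu.-integrable setT (fun y => (f y ^+ 2)%:E).
  apply/integrableP; split; first exact: measurable_sqr.
  under eq_integral do rewrite gee0_abs ?lee_fin ?sqr_ge0//.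
  by [].
rewrite /dirichlet /Rintegral.
rewrite (ae_eq_integral
  (fun x => 2^-1%:E * (local_energy T f x + ((f x ^+ 2)%:E - G x)))%E)//.
- rewrite integralZl//; last first.
    by apply: integrableD => //; exact: integrableB.
  rewrite integralD//; last exact: integrableB.
  rewrite (integralB measurableT i2 iG) int_G subee ?adde0; last exact: integrable_fin_num.
  by rewrite fineM//; exact: integrable_fin_num.
- apply/measurable_EFinP; apply: measurable_funM => //.
  by apply: measurable_funB => //; exact: measurable_kapply.
- apply: emeasurable_funM => //; apply: emeasurable_funD.
    exact: measurable_local_energy.
  by apply: emeasurable_funB => //; exact: measurable_sqr.
- have := integrable_ae measurableT iG.
  apply: filterS => x /(_ I) Gx _.
  rewrite local_energyE; last by rewrite ltey_eq Gx.
  rewrite -[in RHS](fineK Gx) -EFinB -EFinD -EFinM; congr EFin.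
  by field.
Qed.

End local_energy.

(** * Splitting the energy and bounding the remainder *)

Section energy_bounds.
Context (d : measure_display) (E : measurableType d) (R : realType).

(** Hölder's inequality for the indicator of [A] with exponent [(1 - p^-1)^-1] and [g] with exponent
    [p]. For a probability measure and [A] the whole space, it is Jensen's inequality for the power
    [p]. *)
Lemma integral_subset_hoelder (m : {measure set E -> \bar R}) (A : set E)
  (g : E -> R) (p : R) : 1 < p -> measurable A ->
  measurable_fun [set: E] g -> (forall x, 0 <= g x) ->
  (\int[m]_(x in A) (g x)%:E <=
   m A `^ (1 - p^-1) * (\int[m]_x (g x `^ p)%:E) `^ p^-1)%E.
Proof.
move=> p1 mA mg g0.
have p0 : 0 < p by exact: lt_trans p1.
have q0 : 0 < 1 - p^-1 by rewrite subr_gt0 invf_lt1.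
have q0' : 0 < (1 - p^-1)^-1 by rewrite invr_gt0.
have := hoelder m (measurable_indic mA) mg q0' p0.
rewrite invrK subrK => /(_ erefl); congr (_ <= _ * _)%E.
- rewrite Lnorm1 [RHS]integral_mkcond; apply: eq_integral => x _ /=.
  rewrite ger0_norm ?mulr_ge0// patchE indicE.
  by case: ifPn => xA; rewrite ?mul1r ?mul0r.
- rewrite unlock invrK; congr (_ `^ _)%E.
  rewrite -[in RHS](setIT A) -integral_indic//.
  apply: eq_integral => x _ /=.
  by rewrite indicE; case: (x \in A); rewrite ?normr1 ?powR1 ?normr0 ?powR0 ?gt_eqF.
- rewrite unlock; congr (_ `^ _)%E.
  by apply: eq_integral => x _ /=; rewrite ger0_norm.
Qed.

Lemma fine_le_EFin (x : \bar R) (r : R) :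
  (0 <= x)%E -> (x <= r%:E)%E -> fine x <= r.
Proof.
move=> x0 xr; rewrite -lee_fin fineK// ge0_fin_numE//.
exact: le_lt_trans xr (ltry r).
Qed.

Lemma powR_sqr_half (x p : R) : (x ^+ 2) `^ p = `|x| `^ (2 * p).
Proof. by rewrite powRrM powR_mulrn// real_normK// num_real. Qed.

(** Finiteness of the integral keeps the [fine] in [rnorm] away from its default value 0; the
    exponents then match, as [2 / (2 * p) = 1 / p]. *)
Lemma rnorm_sqr (mu : {measure set E -> \bar R}) (f : E -> R) (p : R) : 0 < p ->
  (\int[mu]_x (`|f x| `^ (2 * p))%:E < +oo)%E ->
  ((\int[mu]_x (`|f x| `^ (2 * p))%:E) `^ p^-1)%E =
  (rnorm mu (2 * p) f ^+ 2)%:E.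
Proof.
move=> p0 fy; rewrite /rnorm unlock /=.
have -> : (\int[mu]_x `|(f x)%:E| `^ (2 * p) =
           \int[mu]_x (`|f x| `^ (2 * p))%:E)%E by apply: eq_integral.
have I0 : (0 <= \int[mu]_x (`|f x| `^ (2 * p))%:E)%E.
  by apply: integral_ge0 => x _; rewrite lee_fin powR_ge0.
rewrite -(@fineK _ (\int[mu]_x _)%E) ?ge0_fin_numE// /= -powR_mulrn ?powR_ge0//.
rewrite -powRrM; congr (_ `^ _)%:E.
by field; rewrite gt_eqF.
Qed.

(** The step common to all [p]: off [A] the energy of [P] is absorbed by that of the squared kernel,
    so only its integral over [A] remains to be estimated. *)
Lemma dirichlet_split (mu : probability E R) (P : R.-pker E ~> E)
  (eps f : E -> R) (s : R) :
  measurable_fun [set: E] eps -> (forall x, 0 <= eps x) ->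
  mu_invariant mu P ->
  (forall x A, measurable A -> ((eps x)%:E * dirac x A <= P x A)%E) ->
  measurable_fun [set: E] f -> (\int[mu]_x (f x ^+ 2)%:E < +oo)%E -> 0 < s ->
  let A := [set x | (s%:E <= inv_ext eps x)%E] in
  measurable A /\
  dirichlet mu P f <= s * dirichlet mu (mkcomp_noparam P P) f +
    2^-1 * fine (\int[mu]_(x in A) local_energy P f x)%E.
Proof.
move=> meps eps0 muP epsP mf f2 s0 A.
(* The division-free form also covers [eps x = 0], where both conditions hold, and makes
   measurability of [A] immediate. *)
have AE : A = [set x | eps x * s <= 1].
  apply/seteqP; split=> x /=; rewrite /A/= /inv_ext;
    case: eqP => [->|/eqP e0]; rewrite ?mul0r ?ler01 ?leey// lee_fin;
    by rewrite -[_^-1]mul1r ler_pdivlMr ?lt_def ?e0 ?eps0// mulrC.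
have mA : measurable A.
  rewrite AE -[X in measurable X]setTI.
  by apply: measurable_fun_le => //; exact: measurable_funM.
split => //.
have P1 x : P x setT = 1%E by exact: prob_kernel.
have PP1 x : mkcomp_noparam P P x setT = 1%E.
  rewrite /mkcomp_noparam/= /kcomp_noparam.
  by under eq_integral do rewrite P1; rewrite integral_cst// mul1e P1.
have muPP := mu_invariant_comp muP muP.
have mH := measurable_local_energy P mf.
have mHH := measurable_local_energy (mkcomp_noparam P P) mf.
have H0 := @local_energy_ge0 _ _ _ P f.
have HH0 := @local_energy_ge0 _ _ _ (mkcomp_noparam P P) f.
have Hy := integral_local_energy_lty muP P1 mf f2.
have HHy := integral_local_energy_lty muPP PP1 mf f2.
rewrite (dirichletE muP P1 mf f2) (dirichletE muPP PP1 mf f2).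
have mCA : measurable (~` A) by exact: measurableC.
have HA : (\int[mu]_(x in A) local_energy P f x < +oo)%E.
  by apply: le_lt_trans Hy; exact: ge0_subset_integral.
have HCA : (\int[mu]_(x in ~` A) local_energy P f x <=
            s%:E * \int[mu]_x local_energy (mkcomp_noparam P P) f x)%E.
  apply: (@le_trans _ _
    (\int[mu]_(x in ~` A) (s%:E * local_energy (mkcomp_noparam P P) f x))%E).
    apply: ge0_le_integral => //.
    - exact: measurable_funTS.
    - by apply: measurable_funTS; exact: emeasurable_funM.
    - move=> x; rewrite AE /= => /negP; rewrite -ltNge => /ltW se.
      (* Here [s * eps x > 1], so inserting this factor only increases the energy; [eps x] is then
         absorbed by passing from [P x] to the squared kernel, with the same integrand. *)
      apply: (@le_trans _ _ (s%:E * ((eps x)%:E * local_energy P f x))%E).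
        by rewrite muleA -EFinM -[leLHS]mul1e lee_wpmul2r// lee_fin mulrC.
      rewrite lee_wpmul2l ?lee_fin ?(ltW s0)//.
      rewrite /local_energy; apply: integral_scale_le => //.
      - exact: (kernel_sqr_ge (eps0 x) (epsP x)).
      - exact: measurable_sqrB.
      - by move=> y; rewrite lee_fin sqr_ge0.
  rewrite -ge0_integralZl ?lee_fin ?(ltW s0)//.
  apply: ge0_subset_integral => //; first exact: emeasurable_funM.
  by move=> x _; rewrite mule_ge0// lee_fin (ltW s0).
(* After cancelling [2^-1], all integrals are shown finite so that [fine] can be removed and the
   comparison made in [\bar R]. *)
rewrite mulrCA -mulrDr ler_pM2l ?invr_gt0//.
have -> : s * fine (\int[mu]_x local_energy (mkcomp_noparam P P) f x)%E =
    fine (s%:E * \int[mu]_x local_energy (mkcomp_noparam P P) f x)%E.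
  by rewrite fineM// ge0_fin_numE// integral_ge0.
have fA : (\int[mu]_(x in A) local_energy P f x)%E \is a fin_num.
  by rewrite ge0_fin_numE// integral_ge0.
have fHH : (s%:E * \int[mu]_x local_energy (mkcomp_noparam P P) f x)%E
    \is a fin_num.
  by rewrite fin_numM// ge0_fin_numE// integral_ge0.
rewrite -fineD// fine_le//.
- by rewrite ge0_fin_numE// integral_ge0.
- by rewrite fin_numD fHH.
rewrite -(setUv A) ge0_integral_setU ?setUv//; last first.
  by apply/disj_setPS; rewrite setICr.
by rewrite addeC leeD2r.
Qed.

(** The [f x] and [f y] parts of the energy each contribute 2 to the constant 4. The second is
    brought back to the norm of [f] by Jensen's inequality under [T x], then invariance. *)
Lemma integral_local_energy_Lp (mu : probability E R) (T : R.-pker E ~> E)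
  (f : E -> R) (p : R) (A : set E) : 1 < p -> mu_invariant mu T ->
  measurable_fun [set: E] f -> measurable A ->
  (\int[mu]_x (`|f x| `^ (2 * p))%:E < +oo)%E ->
  (\int[mu]_x (f x ^+ 2)%:E < +oo)%E ->
  (\int[mu]_(x in A) local_energy T f x <=
   4%:E * (mu A `^ (1 - p^-1) * (rnorm mu (2 * p) f ^+ 2)%:E))%E.
Proof.
move=> p1 muT mf mA fp f2.
have p0 : 0 < p by exact: lt_trans p1.
have T1 x : T x setT = 1%E by exact: prob_kernel.
have m2 := measurable_sqr mf.
have mfp : measurable_fun [set: E] (fun x => (`|f x| `^ (2 * p))%:E).
  apply/measurable_EFinP.
  apply: (@measurableT_comp _ _ _ _ _ _ (@powR R ^~ (2 * p))) => //.
  exact: measurableT_comp.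
pose G x := (\int[T x]_y (f y ^+ 2)%:E)%E.
pose Gp x := (\int[T x]_y (`|f y| `^ (2 * p))%:E)%E.
have G0 x : (0 <= G x)%E.
  by apply: integral_ge0 => y _; rewrite lee_fin sqr_ge0.
have Gp0 x : (0 <= Gp x)%E.
  by apply: integral_ge0 => y _; rewrite lee_fin powR_ge0.
have mG : measurable_fun [set: E] G.
  apply: measurable_fun_integral_kernel => //; first exact: measurable_kernel.
  by move=> z; rewrite lee_fin sqr_ge0.
have mGp : measurable_fun [set: E] Gp.
  by apply: measurable_fun_integral_kernel => //; exact: measurable_kernel.
have jensen x : (G x `^ p <= Gp x)%E.
  have := integral_subset_hoelder (T x) p1 measurableT
    (measurable_funX 2 mf) (fun x => sqr_ge0 (f x)).
  under [X in (_ <= _ * X `^ _)%E -> _]eq_integral do rewrite powR_sqr_half.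
  rewrite T1 poweR1r mul1e => /(gt0_ler_poweR (ltW p0)).
  rewrite -poweRrM mulVf ?gt_eqF// poweRe1; last exact: Gp0.
  by apply; rewrite in_itv/= leey andbT; [exact: G0|exact: poweR_ge0].
have intG : (\int[mu]_x G x = \int[mu]_x (f x ^+ 2)%:E)%E.
  apply: integral_mu_invariant => //.
  by move=> z; rewrite lee_fin sqr_ge0.
have intGp : (\int[mu]_x Gp x = \int[mu]_x (`|f x| `^ (2 * p))%:E)%E.
  by apply: integral_mu_invariant => // z; rewrite lee_fin powR_ge0.
have mfG : measurable_fun [set: E] (fine \o G).
  by apply: (@measurableT_comp _ _ _ _ _ _ fine) => //=; exact: fine_measurable.
have Gfin : \forall x \ae mu, G x = (fine (G x))%:E.
  have : mu.-integrable setT G.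
    apply/integrableP; split => //.
    by under eq_integral do rewrite gee0_abs//; rewrite intG.
  move/(integrable_ae measurableT); apply: filterS => x /(_ I) Gx.
  by rewrite fineK.
have bound1 : (\int[mu]_(x in A) (f x ^+ 2)%:E <=
    mu A `^ (1 - p^-1) * (rnorm mu (2 * p) f ^+ 2)%:E)%E.
  rewrite -rnorm_sqr//.
  have := integral_subset_hoelder mu p1 mA
    (measurable_funX 2 mf) (fun x => sqr_ge0 (f x)).
  by under [X in (_ <= _ * X `^ _)%E -> _]eq_integral do rewrite powR_sqr_half.
have bound2 : (\int[mu]_(x in A) G x <=
    mu A `^ (1 - p^-1) * (rnorm mu (2 * p) f ^+ 2)%:E)%E.
  (* The Hölder bound takes real-valued functions, so [G] is replaced by its almost everywhere equal
     real part. *)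
  rewrite (ae_eq_integral (EFin \o (fine \o G)))//; first last.
  - by apply: filterS Gfin => x Gx _.
  - by apply: measurable_funTS; exact/measurable_EFinP.
  - exact: measurable_funTS.
  apply: le_trans (integral_subset_hoelder mu p1 mA mfG _) _.
    by move=> x; exact: fine_ge0.
  rewrite lee_wpmul2l ?poweR_ge0// -rnorm_sqr//.
  apply: gt0_ler_poweR.
  - by rewrite invr_ge0 ltW.
  - rewrite in_itv/= leey andbT.
    by apply: integral_ge0 => x _; rewrite lee_fin powR_ge0.
  - rewrite in_itv/= leey andbT.
    by apply: integral_ge0 => x _; rewrite lee_fin powR_ge0.
  rewrite -intGp; apply: ge0_le_integral => //.
  - by move=> x _; rewrite lee_fin powR_ge0.
  - apply/measurable_EFinP.
    exact: (@measurableT_comp _ _ _ _ _ _ (@powR R ^~ p)).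
  move=> x _; apply: le_trans (jensen x).
  (* Where [G x] is infinite, [fine] gives 0 on the left, while the right side is [+oo] because [p]
     is nonzero. *)
  rewrite /=; case: (G x) (G0 x) => [r| |] //= _.
  by rewrite gt_eqF ?leey.
have mH := measurable_local_energy T mf.
apply: (@le_trans _ _
  (\int[mu]_(x in A) (2%:E * (f x ^+ 2)%:E + 2%:E * G x))%E).
  apply: ge0_le_integral => //.
  - by move=> x _; exact: local_energy_ge0.
  - exact: measurable_funTS.
  - by apply: measurable_funTS; apply: emeasurable_funD; exact: emeasurable_funM.
  - by move=> x _; exact: (local_energy_le (T1 x) mf).
rewrite ge0_integralD//; first last.
- by apply: measurable_funTS; exact: emeasurable_funM.
- by move=> x _; rewrite mule_ge0.
- by apply: measurable_funTS; exact: emeasurable_funM.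
- by move=> x _; rewrite -EFinM lee_fin mulr_ge0// sqr_ge0.
rewrite !ge0_integralZl//; first last.
- by move=> x _; rewrite lee_fin sqr_ge0.
- exact: measurable_funTS.
- exact: measurable_funTS.
have -> : 4%:E = (2%:E + 2%:E)%E :> \bar R by rewrite -EFinD; congr EFin; ring.
rewrite ge0_muleDl ?lee_fin//.
by apply: leeD; rewrite lee_wpmul2l// lee_fin.
Qed.

(** For almost every [x], both [f x] and, by [ae_mu_invariant], [f y] for [T x]-almost every [y] lie
    in [[a, b]]; hence the squared increment is at most [(b - a) ^+ 2]. *)
Lemma integral_local_energy_osc (mu : probability E R) (T : R.-pker E ~> E)
  (f : E -> R) (a b : R) (A : set E) : mu_invariant mu T ->
  measurable_fun [set: E] f -> measurable A ->
  (\forall x \ae mu, a <= f x <= b) ->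
  (\int[mu]_(x in A) local_energy T f x <= ((b - a) ^+ 2)%:E * mu A)%E.
Proof.
move=> muT mf mA fab.
rewrite -integral_cst//.
apply: ae_ge0_le_integral => //.
- by move=> x _; exact: local_energy_ge0.
- by apply: measurable_funTS; exact: measurable_local_energy.
- by move=> x _; rewrite lee_fin sqr_ge0.
have := ae_mu_invariant muT fab.
apply: filterS2 fab => x /andP[ax xb] fTab _.
apply: (@le_trans _ _ (\int[T x]__ ((b - a) ^+ 2)%:E)%E); last first.
  by rewrite integral_cst// prob_kernel mule1.
apply: ae_ge0_le_integral => //.
- by move=> y _; rewrite lee_fin sqr_ge0.
- exact: measurable_sqrB.
- by move=> y _; rewrite lee_fin sqr_ge0.
apply: filterS fTab => y /andP[ay yb] _.
by rewrite lee_fin; nra.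
Qed.

End energy_bounds.

(** * Square-integrability and the essential range of [f] *)

Section square_integrability.
Context (d : measure_display) (E : measurableType d) (R : realType).
Context (mu : probability E R) (f : E -> R).
Hypothesis mf : measurable_fun [set: E] f.

Lemma Lp_sqr_integrable (p : R) : 1 < p ->
  (\int[mu]_x (`|f x| `^ (2 * p))%:E < +oo)%E ->
  (\int[mu]_x (f x ^+ 2)%:E < +oo)%E.
Proof.
move=> p1 fp.
have := integral_subset_hoelder mu p1 measurableT
  (measurable_funX 2 mf) (fun x => sqr_ge0 (f x)).
under [X in (_ <= _ * X `^ _)%E -> _]eq_integral do rewrite powR_sqr_half.
rewrite rnorm_sqr ?(lt_trans ltr01 p1)// => /le_lt_trans; apply.
rewrite [X in (X `^ _)%E](_ : _ = 1%E); last exact: probability_setT.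
by rewrite poweR1r mul1e ltry.
Qed.

Hypothesis fy : (Lnorm mu +oo%E (EFin \o f) < +oo)%E.

(** The norm of exponent [+oo] unfolds to an essential supremum only on a space of positive mass. *)
Let mu_gt0 : (0 < mu [set: E])%E.
Proof. by rewrite probability_setT lte01. Qed.

Let ae_bounded : exists M, \forall x \ae mu, `|f x| <= M.
Proof.
by apply: ess_supr_bounded; move: fy; rewrite unlock mu_gt0.
Qed.

Lemma Linfty_sqr_integrable : (\int[mu]_x (f x ^+ 2)%:E < +oo)%E.
Proof.
have [M fM] := ae_bounded.
apply: (@le_lt_trans _ _ (\int[mu]__ (M ^+ 2)%:E)%E); last first.
  rewrite integral_cst// [X in (_ * X)%E](_ : _ = 1%E) ?mule1 ?ltry//.
  exact: probability_setT.
apply: ae_ge0_le_integral => //.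
- by move=> x _; rewrite lee_fin sqr_ge0.
- exact: measurable_sqr.
- by move=> x _; rewrite lee_fin sqr_ge0.
- apply: filterS fM => x fM _.
  by rewrite lee_fin -(real_normK (num_real (f x))) lerXn2r// ?nnegrE//;
    exact: le_trans fM.
Qed.

(** The witnesses are the essential infimum and supremum. Both are finite, so [osc_norm] is their
    true difference and not a default value of [fine]. *)
Lemma ae_osc_norm : exists a b,
  osc_norm mu f = b - a /\ \forall x \ae mu, a <= f x <= b.
Proof.
have [M fM] := ae_bounded.
(* Stated for any [g] so as to apply to [- f] too: the essential infimum of [f] is minus the
   essential supremum of [- f]. *)
have ess_sup_fin : forall g : E -> R, (\forall x \ae mu, `|g x| <= M) ->
    ess_sup mu (EFin \o g) \is a fin_num.
  move=> g gM; rewrite fin_real//; apply/andP; split.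
    apply: (@lt_le_trans _ _ (- M)%:E); first exact: ltNyr.
    apply: ess_sup_gee => //; apply: filterS gM => x.
    by rewrite ler_norml lee_fin => /andP[].
  apply: (@le_lt_trans _ _ M%:E); last exact: ltry.
  by apply/ess_supP; apply: filterS gM => x; rewrite ler_norml lee_fin => /andP[].
have sf := ess_sup_fin f fM.
have nf : ess_inf mu (EFin \o f) \is a fin_num.
  rewrite ess_infEN fin_numN; apply: (ess_sup_fin (\- f)).
  by apply: filterS fM => x; rewrite normrN.
exists (fine (ess_inf mu (EFin \o f))), (fine (ess_sup mu (EFin \o f))).
split; first by rewrite /osc_norm fineB.
apply: filterS2 (ess_inf_le mu (EFin \o f)) (ess_sup_ge mu (EFin \o f)).
by move=> x fa fb; rewrite -!lee_fin !fineK// fa.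
Qed.

End square_integrability.

(** * Assembly for finite and infinite [p] *)

Theorem theorem38 (d : measure_display) (E : measurableType d) (R : realType)
  (mu : probability E R) (P : R.-pker E ~> E) (eps : E -> R) :
  measurable_fun [set: E] eps ->
  (forall x, 0 <= eps x <= 1) ->
  mu_invariant mu P ->
  (forall x A, measurable A -> ((eps x)%:E * dirac x A <= P x A)%E) ->
  (* (1) *)
  (forall x A, measurable A ->
     ((eps x)%:E * P x A <= mkcomp_noparam P P x A)%E) /\
  (* (2), p in (1, oo), 1/q = 1 - 1/p *)
  (forall (p : R) (f : E -> R) (s : R), 1 < p ->
     measurable_fun [set: E] f ->
     (\int[mu]_x (`|f x| `^ (2 * p))%:E < +oo)%E ->
     Rintegral mu [set: E] f = 0 ->
     0 < s ->
     dirichlet mu P f <=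
       s * dirichlet mu (mkcomp_noparam P P) f
       + fine (mu [set x | (s%:E <= inv_ext eps x)%E]) `^ (1 - p^-1)
         * (4 * rnorm mu (2 * p) f ^+ 2)) /\
  (* (2), p = oo, 1/q = 1 *)
  (forall (f : E -> R) (s : R),
     measurable_fun [set: E] f ->
     (Lnorm mu +oo%E (EFin \o f) < +oo)%E ->
     Rintegral mu [set: E] f = 0 ->
     0 < s ->
     dirichlet mu P f <=
       s * dirichlet mu (mkcomp_noparam P P) f
       + fine (mu [set x | (s%:E <= inv_ext eps x)%E]) * osc_norm mu f ^+ 2).
Proof.
move=> meps eps01 muP epsP.
have eps0 x : 0 <= eps x by case/andP: (eps01 x).
split; first by move=> x; exact: (kernel_sqr_ge (eps0 x) (epsP x)).
split=> [p f s p1 mf fp _ s0|f s mf fy _ s0].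
- have f2 := Lp_sqr_integrable mf p1 fp.
  have [mA split] := dirichlet_split meps eps0 muP epsP mf f2 s0.
  apply: (le_trans split); rewrite lerD2l.
  set A := [set x | _] in mA *; set C := fine (mu A) `^ _ * _.
  have C0 : 0 <= C by rewrite /C mulr_ge0 ?powR_ge0// mulr_ge0 ?sqr_ge0.
  (* The split yields half of the stated remainder [C]; nonnegativity of [C] gives away the factor
     2. *)
  apply: (@le_trans _ _ (2^-1 * C)); last by lra.
  rewrite ler_pM2l ?invr_gt0//; apply: fine_le_EFin.
    by apply: integral_ge0 => x _; exact: local_energy_ge0.
  have := integral_local_energy_Lp p1 muP mf mA fp f2.
  rewrite /C !EFinM -poweR_EFin (@fineK _ (mu A)).
    by rewrite muleCA.
  exact: fin_num_measure.
- have f2 := Linfty_sqr_integrable mf fy.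
  have [mA split] := dirichlet_split meps eps0 muP epsP mf f2 s0.
  have [a [b [-> fab]]] := ae_osc_norm fy.
  apply: (le_trans split); rewrite lerD2l.
  set A := [set x | _] in mA *; set C := fine (mu A) * _.
  have C0 : 0 <= C by rewrite /C mulr_ge0 ?fine_ge0 ?sqr_ge0.
  apply: (@le_trans _ _ (2^-1 * C)); last by lra.
  rewrite ler_pM2l ?invr_gt0//; apply: fine_le_EFin.
    by apply: integral_ge0 => x _; exact: local_energy_ge0.
  rewrite /C EFinM (@fineK _ (mu A)).
    by rewrite muleC; exact: integral_local_energy_osc.
  exact: fin_num_measure.
Qed.
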